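(* Let $G=(V,E)$ be a finite graph and let $\mathcal{S}=\{S_i\}_{i\in V}$ be a scale on $G$. The measure problem (M) and the linear problem (L) described in the context are equivalent: their admissible solutions are paired by setting $\xi_i(j)=x_{i,j}$ and $\varepsilon=e$. That is, $(\{\xi_i\}_{i\in V},\varepsilon)$ is admissible for (M) if and only if there exist reals $e_{ij,k}$ ($ij\in E$, $k\in V$) such that $\left((x_{i,j})_{i,j\in V},(e_{ij,k})_{ij\in E,k\in V},e\right)$ with $x_{i,j}=\xi_i(j)$ and $e=\varepsilon$ is admissible for (L).
   Context: A graph $G=(V,E)$ is oriented, with $E\subset V\times V$ and no self-loops; $ij\in E$ denotes an edge with initial vertex $i$ and terminal vertex $j$. A scale on $G$ is a family $\mathcal{S}=\{S_i\}_{i\in V}$ of subsets of $V$. (M): minimize $\varepsilon\ge 0$ over pairs $(\{\xi_i\colon V\to\mathbb{R}\}_{i\in V},\varepsilon)$ such that (1) $\xi_i\ge 0$ and $\|\xi_i\|_1=1$ for each $i\in V$; (2) $\|\xi_i-\xi_j\|_1\le\varepsilon$ for each $ij\in E$; (3) $\{j\in V:\xi_i(j)>0\}\subset S_i$ for each $i\in V$. (L): minimize $e$ subject to - $\sum_{j\in V}x_{i,j}=1$ for each $i\in V$; - $x_{i,j}=0$ for each $i\in V$, $j\in V\setminus S_i$; - $x_{j,k}-x_{i,k}\le e_{ij,k}$ and $x_{i,k}-x_{j,k}\le e_{ij,k}$ for each $ij\in E$, $k\in V$; - $\sum_{k\in V}e_{ij,k}\le e$ for each $ij\in E$; - $x_{i,j},\,e_{ij,k},\,e\ge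 0$. A solution is admissible if it satisfies all the constraints. *)

(* Defs.v *)
From HB Require Import structures.
From mathcomp Require Import all_boot all_order all_algebra.
From mathcomp Require Import reals.

Set Implicit Arguments.
Unset Strict Implicit.
Unset Printing Implicit Defensive.

Import Order.TTheory GRing.Theory Num.Theory.
Local Open Scope ring_scope.

(* Both (i, j) and (j, i) may be edges; [(i, j)] is the edge from i to j. *)
Record fin_graph := FinGraph {
  vertex :> finType;
  edges : {set vertex * vertex};
  no_self_loop : forall i : vertex, (i, i) \notin edges
}.

Definition edge (G : fin_graph) := {ij : G * G | ij \in edges G}.

Definition source (G : fin_graph) (a : edge G) : G := (val a).1.
Definition target (G : fin_graph) (a : edge G) : G := (val a).2.

Definition scale (G : fin_graph) := G -> {set G}.

Definition l1norm (R : realType) (T : finType) (f : T -> R) : R :=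
  \sum_(k : T) `|f k|.

Record admissible_M (R : realType) (G : fin_graph) (S : scale G)
    (xi : G -> G -> R) (eps : R) : Prop := {
  M_eps_ge0 : 0 <= eps;
  M_ge0 : forall i j : G, 0 <= xi i j;
  M_norm : forall i : G, l1norm (xi i) = 1;
  M_edge : forall i j : G, (i, j) \in edges G -> l1norm (xi i \- xi j) <= eps;
  M_supp : forall i : G, [set j : G | 0 < xi i j] \subset S i
}.

(* As in the linear program, the variables [d a k], written e_{ij,k} in the
   mathematics, exist only for actual edges a = ij. *)
Record admissible_L (R : realType) (G : fin_graph) (S : scale G)
    (x : G -> G -> R) (d : edge G -> G -> R) (e : R) : Prop := {
  L_sum : forall i : G, \sum_(j : G) x i j = 1;
  L_supp : forall i j : G, j \notin S i -> x i j = 0;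
  L_diff_ts : forall (a : edge G) (k : G),
    x (target a) k - x (source a) k <= d a k;
  L_diff_st : forall (a : edge G) (k : G),
    x (source a) k - x (target a) k <= d a k;
  L_edge : forall a : edge G, \sum_(k : G) d a k <= e;
  L_x_ge0 : forall i j : G, 0 <= x i j;
  L_d_ge0 : forall (a : edge G) (k : G), 0 <= d a k;
  L_e_ge0 : 0 <= e
}.

(* Main.v *)
Require Import Defs.
From mathcomp Require Import all_boot all_order all_algebra.
From mathcomp Require Import reals.

Import Order.TTheory GRing.Theory Num.Theory.
Local Open Scope ring_scope.

(** Since [`|t|] is the least number above both [t] and [- t], the two
    difference constraints on an edge [a] say that [d a k] dominates
    [`|xi (source a) k - xi (target a) k|]. Summing over [k], the bound on
    [\sum_k d a k] can be met for some [d] exactly when it is met by the least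
    candidate, the absolute difference itself, and then it is the l1 bound of
    the measure problem. The vertex constraints agree because a nonnegative
    function has its sum as l1 norm, and vanishes wherever it is not positive. *)

Lemma l1norm_ge0_sum (R : realType) (T : finType) (f : T -> R) :
  (forall k, 0 <= f k) -> l1norm f = \sum_k f k.
Proof. by move=> f0; apply: eq_bigr => k _; rewrite ger0_norm. Qed.

Theorem proposition2p5 (R : realType) (G : fin_graph) (S : scale G)
    (xi : G -> G -> R) (eps : R) :
  admissible_M S xi eps <->
  exists d : edge G -> G -> R, admissible_L S (fun i j => xi i j) d eps.
Proof.
split=> [[eps0 xi0 xi1 xiE xiS] | [d [xi1 xiS dts dst dE xi0 d0 eps0]]].
- exists (fun a k => `|xi (source a) k - xi (target a) k|); split=> //.
  + by move=> i; rewrite -l1norm_ge0_sum.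
  + move=> i j jS; apply/eqP; rewrite eq_le xi0 andbT leNgt.
    by apply: contra jS => xij; apply: (subsetP (xiS i)); rewrite inE.
  + by move=> a k; rewrite distrC ler_norm.
  + by move=> a k; rewrite ler_norm.
  + by move=> [[i j] ijE]; apply: xiE.
- split=> // [i | i j ijE | i].
  + by rewrite l1norm_ge0_sum.
  + pose a : edge G := exist _ (i, j) ijE.
    apply: le_trans (dE a); apply: ler_sum => k _.
    by rewrite ler_norml lerNl opprB (dts a k) (dst a k).
  + apply/subsetP => j; rewrite inE; apply: contraTT => jS.
    by rewrite xiS // ltxx.
Qed.
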